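(* Let $\Theta$ be the $\mathfrak{spin}(7)$-invariant four-form on $V=\mathbb{R}^8$. Then $b_\Theta:\Lambda^3V\to\Lambda^3V$ with $(b_\Theta)_{lmn}{}^{ijk}=\Theta_{[lm}{}^{[ij}\delta_{n]}^{k]}$ is a perfect duality operator of order two that obeys $$(b_\Theta)^2=\frac{8}{3}\,\mathrm{id}-\frac{10}{3}\,b_\Theta .$$ Its eigenvalues are $-4$ and $\frac23$, whose eigenspaces are, respectively, the eight-dimensional and the $48$-dimensional irreducible $\mathfrak{spin}(7)$-invariant subspaces of $\Lambda^3V$.
   Context: $V=\mathbb{R}^8$ is Euclidean with oriented orthonormal basis $e_1,\ldots,e_8$; indices are raised with the metric, repeated indices are summed, and square brackets denote weight-one antisymmetrization. $\Theta\in\Lambda^4\mathbb{R}^8$ has totally antisymmetric components determined by $\Theta_{ijkl}=1$ for $(ijkl)=(1245),(1276),(1346),(1357),(2356),(2437),(4567),(1238),(4358),(4718),(5168),(5728),(6248),(6738)$, all components with index sets not listed being zero. $\mathfrak{spin}(7)\subset\mathfrak{so}(8)$ denotes the stabilizer of $\Theta$. Acting on $F\in\Lambda^3V$, $b_\Theta(F)_{lmn}=\Theta_{ij[lm}F^{ij}{}_{n]}$. A duality operator has order $N$ if it has exactly $N$ distinct eigenvalues; for a form invariant under a subalgebra $\mathfrak h\subset\mathfrak{so}(V)$, the operator on $\Lambda^kV$ is called perfect if its order equals the number of irreducible $\mathfrak h$-submodules in the decomposition of $\Lambda^kV$ (here $\mathfrak h=\mathfrak{spin}(7)$). *)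

(* Defs.v *)
From HB Require Import structures.
From mathcomp Require Import all_boot all_order all_algebra all_fingroup reals.

Set Implicit Arguments.
Unset Strict Implicit.
Unset Printing Implicit Defensive.

Import Order.TTheory GRing.Theory Num.Theory.
Import passmx.
Local Open Scope ring_scope.

(* The components T_{i_1 ... i_k} of a tensor on R^d in the standard
   orthonormal basis; upper and lower indices need not be distinguished.       *)
Notation tensor R d k := {ffun k.-tuple 'I_d -> R^o}.

Section Forms.
Variables (R : realType) (d : nat).

Definition perm_idx k (s : 'S_k) (i : k.-tuple 'I_d) : k.-tuple 'I_d :=
  [tuple tnth i (s p) | p < k].

(* Weight-one antisymmetrization T_{[i_1 ... i_k]}. *)
Definition alt k (F : tensor R d k) : tensor R d k :=
  [ffun i => (k`!)%:R^-1 * \sum_(s : 'S_k) (-1) ^+ s * F (perm_idx s i)].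

Fact alt_is_linear k : linear (@alt k).
Proof.
move=> a F G; apply/ffunP=> i; rewrite !ffunE /GRing.scale /=.
rewrite mulrCA -mulrDr; congr (_ * _); rewrite mulr_sumr -big_split /=.
by apply: eq_bigr => s _; rewrite !ffunE mulrDr mulrCA.
Qed.

HB.instance Definition _ k :=
  GRing.isLinear.Build R (tensor R d k) (tensor R d k) _ (@alt k)
    (@alt_is_linear k).

(* Lambda^k R^d is the space of the F with F_{i_1...i_k} = F_{[i_1...i_k]}. *)
Definition altspace k : {vspace tensor R d k} := fixedSpace (linfun (@alt k)).

Definition kform k := subvs_of (altspace k).
HB.instance Definition _ k := Vector.on (kform k).

Lemma perm_idxM k (s t : 'S_k) i :
  perm_idx s (perm_idx t i) = perm_idx (s * t)%g i.
Proof. by apply: eq_from_tnth => p; rewrite !tnth_mktuple permM. Qed.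

Lemma perm_idx_perm_eq k (s : 'S_k) (i : k.-tuple 'I_d) :
  perm_eq (perm_idx s i) i.
Proof. by apply/tuple_permP; exists s. Qed.

Lemma altspaceP k (F : tensor R d k) :
  reflect (forall (s : 'S_k) i, F (perm_idx s i) = (-1) ^+ s * F i)
          (F \in altspace k).
Proof.
apply: (iffP fixedSpaceP); rewrite lfunE /= => altF.
  move=> s i; rewrite -altF !ffunE mulrCA; congr (_ * _).
  rewrite mulr_sumr (reindex_inj (mulIg s^-1%g)) /=; apply: eq_bigr => t _.
  by rewrite perm_idxM mulgKV odd_permM odd_permV signr_addb mulrCA mulrA.
apply/ffunP=> i; rewrite ffunE.
under eq_bigr => s _ do rewrite altF signrMK.
rewrite sumr_const card_Sn -[X in _ * X]mulr_natl mulKf //.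
by rewrite pnatr_eq0 -lt0n fact_gt0.
Qed.

Lemma alt_in k (F : tensor R d k) : alt F \in altspace k.
Proof.
apply/altspaceP => s i; rewrite !ffunE mulrCA; congr (_ * _).
rewrite mulr_sumr (reindex_inj (mulIg s^-1%g)) /=; apply: eq_bigr => t _.
by rewrite perm_idxM mulgKV odd_permM odd_permV signr_addb mulrCA mulrA.
Qed.

Definition subst_idx k (i : k.-tuple 'I_d) (p : 'I_k) (j : 'I_d) :=
  [tuple if q == p then j else tnth i q | q < k].

(* The action of A in gl(d) on tensors:
   (A.F)_{i_1...i_k} = sum_p sum_j A_{i_p j} F_{i_1 ... j ... i_k}.           *)
Definition tensor_act k (A : 'M[R]_d) (F : tensor R d k) : tensor R d k :=
  [ffun i => \sum_(p < k) \sum_(j < d) A (tnth i p) j * F (subst_idx i p j)].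

Fact tensor_act_in k A (F : kform k) : tensor_act A (vsval F) \in altspace k.
Proof.
have /altspaceP altF := valP F; apply/altspaceP => s i; rewrite !ffunE.
rewrite mulr_sumr (reindex_inj (@perm_inj _ s^-1%g)) /=; apply: eq_bigr => p _.
rewrite mulr_sumr; apply: eq_bigr => j _; rewrite tnth_mktuple permKV mulrCA.
congr (_ * _); rewrite -[RHS]altF; congr (vsval F _).
apply: eq_from_tnth => q; rewrite !tnth_mktuple.
by rewrite (can2_eq (permK s) (permKV s)).
Qed.

Definition kform_act k (A : 'M[R]_d) (F : kform k) : kform k :=
  Subvs (tensor_act_in A F).

Definition so_alg : {pred 'M[R]_d} := [pred A | A^T == - A].

Definition so_subalgebra (h : {pred 'M[R]_d}) : Prop :=
  [/\ {subset h <= so_alg}, submod_closed h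
    & forall A B, A \in h -> B \in h -> A *m B - B *m A \in h].

Definition stabilizer k (F : kform k) : {pred 'M[R]_d} :=
  [pred A | (A \in so_alg) && (kform_act A F == 0)].

Section Modules.
Variables (h : {pred 'M[R]_d}) (k : nat).

Definition invariant_form (F : kform k) : Prop :=
  forall A, A \in h -> kform_act A F = 0.

Definition submodule (W : {vspace kform k}) : Prop :=
  forall A F, A \in h -> F \in W -> kform_act A F \in W.

Definition irreducible (W : {vspace kform k}) : Prop :=
  [/\ submodule W, W != 0%VS
    & forall U : {vspace kform k},
        submodule U -> (U <= W)%VS -> U = 0%VS \/ U = W].

(* By Krull-Schmidt, n does not depend on the chosen decomposition. *)
Definition num_irreducibles (n : nat) : Prop :=
  exists W : 'I_n -> {vspace kform k},
    [/\ forall i, irreducible (W i), (\sum_i W i = fullv)%VS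
      & directv (\sum_i W i)%VS].

End Modules.

Definition has_order k (f : 'End(kform k)) (N : nat) : Prop :=
  exists s : seq R,
    [/\ uniq s, size s = N & forall a, leigenvalue f a = (a \in s)].

(* Used with f the operator on Lambda^k built from the h-invariant form Om. *)
Definition perfect (h : {pred 'M[R]_d}) p (Om : kform p) k (f : 'End(kform k)) :
    Prop :=
  [/\ so_subalgebra h, invariant_form h Om
    & exists2 N, has_order f N & num_irreducibles h k N].

Section Operator.
Variable Om : kform 4.

(* The tensor Om_{ijlm} F^{ij}_n with free indices l, m, n. *)
Definition contraction (F : kform 3) : tensor R d 3 :=
  [ffun t => let l := tnth t 0 in let m := tnth t 1 in let n := tnth t 2%:R in
     \sum_(i < d) \sum_(j < d)
        vsval Om [tuple i; j; l; m] * vsval F [tuple i; j; n]].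

Definition duality_fun (F : kform 3) : kform 3 := Subvs (alt_in (contraction F)).

Fact duality_fun_is_linear : linear duality_fun.
Proof.
move=> a F G; apply: val_inj; rewrite /= -linearP; congr alt.
apply/ffunP=> t; rewrite !ffunE /GRing.scale /= mulr_sumr -big_split /=.
apply: eq_bigr => i _; rewrite mulr_sumr -big_split /=; apply: eq_bigr => j _.
by rewrite !ffunE mulrDr mulrCA.
Qed.

HB.instance Definition _ :=
  GRing.isLinear.Build R (kform 3) (kform 3) _ duality_fun duality_fun_is_linear.

Definition duality_op : 'End(kform 3) := linfun duality_fun.

(* Om_{[lm}^{[ij} delta_{n]}^{k]}, with t = (l, m, n) and u = (i, j, k). *)
Definition duality_kernel (t u : 3.-tuple 'I_d) : R :=
  alt [ffun t' : 3.-tuple 'I_d =>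
    alt [ffun u' : 3.-tuple 'I_d =>
      vsval Om [tuple tnth t' 0; tnth t' 1; tnth u' 0; tnth u' 1]
        * (tnth t' 2%:R == tnth u' 2%:R)%:R] u] t.

Lemma duality_opE F : vsval (duality_op F) = alt (contraction F).
Proof. by rewrite lfunE. Qed.

End Operator.
End Forms.

(* The index of the basis vector e_n; the numbering e_1, ..., e_8 is 1-based. *)
Definition idx8 (n : nat) : 'I_8 := inord n.-1.

Definition theta_quads : seq (4.-tuple 'I_8) :=
  [seq [tuple of map idx8 q] | q : 4.-tuple nat <-
    [:: [tuple 1; 2; 4; 5]; [tuple 1; 2; 7; 6]; [tuple 1; 3; 4; 6];
        [tuple 1; 3; 5; 7]; [tuple 2; 3; 5; 6]; [tuple 2; 4; 3; 7];
        [tuple 4; 5; 6; 7]; [tuple 1; 2; 3; 8]; [tuple 4; 3; 5; 8];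
        [tuple 4; 7; 1; 8]; [tuple 5; 1; 6; 8]; [tuple 5; 7; 2; 8];
        [tuple 6; 2; 4; 8]; [tuple 6; 7; 3; 8]]%N].

(* 4! times the antisymmetrization turns each listed component into 1; see
   ThetaE and Theta_eq0.                                                      *)
Definition Theta (R : realType) : kform R 8 4 :=
  Subvs (alt_in ((4`!)%:R *: [ffun i => (i \in theta_quads)%:R])).

Lemma Theta_antisym (R : realType) (s : 'S_4) i :
  vsval (Theta R) (perm_idx s i) = (-1) ^+ s * vsval (Theta R) i.
Proof. by have /altspaceP := valP (Theta R); apply. Qed.

Lemma Theta_eq0 (R : realType) (i : 4.-tuple 'I_8) :
  ~~ has (fun q : 4.-tuple 'I_8 => perm_eq i q) theta_quads ->
  vsval (Theta R) i = 0.
Proof.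
move=> /hasPn iP; rewrite !ffunE big1 ?mulr0 // => s _; rewrite !ffunE.
case: (boolP (_ \in _)) => [|_]; last by rewrite scaler0 mulr0.
by move=> /iP; rewrite perm_sym perm_idx_perm_eq.
Qed.

Local Definition quads_nat : seq (seq nat) :=
  [seq map val (val q) | q <- theta_quads].

Local Lemma quads_natE : quads_nat =
  [:: [:: 0; 1; 3; 4]; [:: 0; 1; 6; 5]; [:: 0; 2; 3; 5]; [:: 0; 2; 4; 6];
      [:: 1; 2; 4; 5]; [:: 1; 3; 2; 6]; [:: 3; 4; 5; 6]; [:: 0; 1; 2; 7];
      [:: 3; 2; 4; 7]; [:: 3; 6; 0; 7]; [:: 4; 0; 5; 7]; [:: 4; 6; 1; 7];
      [:: 5; 1; 3; 7]; [:: 5; 6; 2; 7]]%N.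
Proof. by rewrite /quads_nat /= !inordK. Qed.

Lemma ThetaE (R : realType) q : q \in theta_quads -> vsval (Theta R) q = 1.
Proof.
have natP (x : 4.-tuple 'I_8) : x \in theta_quads ->
    map val (val x) \in quads_nat by apply: map_f.
move=> qP; rewrite !ffunE (bigD1 1%g) //= big1 => [|s s_neq1].
  have -> : perm_idx 1%g q = q.
    by apply: eq_from_tnth => p; rewrite tnth_mktuple perm1.
  rewrite odd_perm1 mul1r addr0 !ffunE qP /GRing.scale /= mulr1 mulVf //.
  by rewrite pnatr_eq0 -lt0n fact_gt0.
rewrite !ffunE; case: (boolP (_ \in _)) => [sqP|_]; last by rewrite scaler0 mulr0.
case/eqP: s_neq1; apply/permP=> p; rewrite perm1.
have quadsP : all (fun x => uniq x && all (fun y => perm_eq x y ==> (x == y))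
    quads_nat) quads_nat by rewrite quads_natE.
have /andP[uq _] := allP quadsP _ (natP _ qP).
have /andP[_ /allP/(_ _ (natP _ qP))] := allP quadsP _ (natP _ sqP).
rewrite perm_map ?perm_idx_perm_eq //= => /eqP.
move=> eqm.
have eqq : perm_idx s q = q by apply/val_inj/(inj_map val_inj).
have : tnth (perm_idx s q) p = tnth q p by rewrite eqq.
rewrite tnth_mktuple; apply: tuple_uniqP; exact: map_uniq uq.
Qed.

Definition spin7 (R : realType) : {pred 'M[R]_8} := stabilizer (Theta R).
Arguments spin7 : clear implicits.

(* Main.v *)
(* Call a 4-subset Q of the indices a quad if Theta does not vanish on it.
   For m in Q let f_{m,Q} be the contraction of e_m with the e_Q-summand of
   Theta.  Up to sign the 56 forms f_{m,Q} are the basis 3-forms, and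
   v_m := e_m -| Theta is the sum of the seven f_{m,Q}.  Writing s_m(F) for the
   sum over Q of the f_{m,Q}-coordinates of F, one has
   b F = 2/3 (F - sum_m s_m(F) v_m).  Hence the span of the eight v_m is the
   (-4)-eigenspace, and the common kernel of the s_m, spanned by the 48
   differences n_{m,k} = f_{m,Q_0} - f_{m,Q_k}, is the (2/3)-eigenspace.

   Irreducibility: the elements X = E_ab + E_cd, for (abcd) an even ordering
   of a quad, lie in spin(7).  On 3-forms X^2 (X^2 + 4) is -3 times the
   projection onto the f_{m,Q} with m in the quad, so products of these project
   onto the seven f_{m,Q} with m fixed.  Combined with the Casimir operator,
   resp. with a signed sum of three squares X^2, they give multiples of the
   orthogonal projections onto the lines of v_m and n_{m,k}.  Hence a submodule
   of an eigenspace which is not orthogonal to v_m (resp. n_{m,k}) contains it,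
   and the generators X connect all these vectors to each other.

   All identities are integral and are verified by computation with formal
   integer combinations of components. *)
From HB Require Import structures.
Require Import Defs.
From mathcomp Require Import all_boot all_order all_algebra all_fingroup reals.
From mathcomp Require Import ring.
Set Implicit Arguments.
Unset Strict Implicit.
Unset Printing Implicit Defensive.
Import Order.TTheory GRing.Theory Num.Theory.
Import passmx.
Local Open Scope ring_scope.

(** * The action of so(d) on forms *)

Section TensorAction.
Variables (R : realType) (d : nat).
Implicit Types (A B : 'M[R]_d).

Lemma subst_idxC k (i : k.-tuple 'I_d) p q j l : p != q ->
  subst_idx (subst_idx i p j) q l = subst_idx (subst_idx i q l) p j.
Proof.
move=> npq; apply: eq_from_tnth => r; rewrite !tnth_mktuple.
by case: (eqVneq r q) => // ->; rewrite eq_sym (negPf npq).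
Qed.

Lemma subst_idxK k (i : k.-tuple 'I_d) p j l :
  subst_idx (subst_idx i p j) p l = subst_idx i p l.
Proof. by apply: eq_from_tnth => r; rewrite !tnth_mktuple; case: eqP. Qed.

Lemma subst_idx_id k (i : k.-tuple 'I_d) p : subst_idx i p (tnth i p) = i.
Proof.
by apply: eq_from_tnth => r; rewrite !tnth_mktuple; case: eqP => // ->.
Qed.

(** In a double action the terms that hit one slot twice give the action of the matrix product;
    those that hit two distinct slots commute and cancel. *)
Lemma tensor_act_comm k A B (F : tensor R d k) :
  tensor_act A (tensor_act B F) - tensor_act B (tensor_act A F) =
  tensor_act (A *m B - B *m A) F.
Proof.
have actM (C D : 'M[R]_d) i : tensor_act C (tensor_act D F) i =
    tensor_act (C *m D) F i + \sum_(p < k) \sum_(q < k | q != p)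
    \sum_(j < d) \sum_(l < d) C (tnth i p) j * D (tnth i q) l *
       F (subst_idx (subst_idx i p j) q l).
  rewrite !ffunE -big_split /=; apply: eq_bigr => p _.
  under eq_bigr => j _ do rewrite ffunE mulr_sumr (bigD1 p) //=.
  rewrite big_split /=; congr (_ + _); last first.
    rewrite exchange_big /=; apply: eq_bigr => q nqp; apply: eq_bigr => j _.
    rewrite mulr_sumr; apply: eq_bigr => l _.
    by rewrite tnth_mktuple (negPf nqp) mulrA.
  rewrite (eq_bigr (fun j => \sum_(l < d) C (tnth i p) j * D j l *
      F (subst_idx i p l))).
    rewrite exchange_big /=; apply: eq_bigr => l _.
    by rewrite mxE mulr_suml.
  move=> j _; rewrite mulr_sumr; apply: eq_bigr => l _.
  by rewrite tnth_mktuple eqxx subst_idxK mulrA.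
apply/ffunP => i; rewrite [LHS]ffunE [X in _ + X]ffunE !actM.
set S1 := \sum_p _; set S2 := \sum_p _.
have -> : S1 = S2.
  rewrite /S1 /S2 [RHS](exchange_big_dep xpredT) //=; apply: eq_bigr => p _.
  rewrite big_mkcond [RHS]big_mkcond /=; apply: eq_bigr => q _.
  rewrite eq_sym; case: ifP => // npq; rewrite exchange_big /=.
  apply: eq_bigr => l _; apply: eq_bigr => j _.
  by rewrite [_ * B _ _]mulrC subst_idxC // eq_sym npq.
rewrite opprD addrACA subrr addr0 !ffunE -sumrB; apply: eq_bigr => p _.
by rewrite -sumrB; apply: eq_bigr => j _; rewrite !mxE mulrBl.
Qed.

Lemma tensor_actDl k a A B (F : tensor R d k) :
  tensor_act (a *: A + B) F = a *: tensor_act A F + tensor_act B F.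
Proof.
apply/ffunP => i; rewrite !ffunE /GRing.scale /= mulr_sumr -big_split.
apply: eq_bigr => p _; rewrite mulr_sumr -big_split; apply: eq_bigr => j _.
by rewrite !mxE mulrDl mulrA.
Qed.

Lemma tensor_actDr k a A (F G : tensor R d k) :
  tensor_act A (a *: F + G) = a *: tensor_act A F + tensor_act A G.
Proof.
apply/ffunP => i; rewrite !ffunE /GRing.scale /= mulr_sumr -big_split.
apply: eq_bigr => p _; rewrite mulr_sumr -big_split; apply: eq_bigr => j _.
by rewrite !ffunE mulrDr mulrCA.
Qed.

Definition dot k (F G : tensor R d k) : R := \sum_t F t * G t.

Lemma dotC k (F G : tensor R d k) : dot F G = dot G F.
Proof. by apply: eq_bigr => t _; rewrite mulrC. Qed.

Lemma dotP k a (F G H : tensor R d k) :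
  dot (a *: F + G) H = a * dot F H + dot G H.
Proof.
rewrite mulr_sumr -big_split; apply: eq_bigr => t _.
by rewrite !ffunE mulrDl mulrA.
Qed.

Lemma dot0 k (F : tensor R d k) : dot 0 F = 0.
Proof. by rewrite /dot big1 // => t _; rewrite ffunE mul0r. Qed.

Lemma dot_act k A (F G : tensor R d k) : A \in @so_alg R d ->
  dot (tensor_act A F) G = - dot F (tensor_act A G).
Proof.
move=> /eqP Aso; rewrite /dot -sumrN.
have dotE (H K : tensor R d k) :
    \sum_t tensor_act A H t * K t = \sum_(p < k) \sum_(u : k.-tuple 'I_d * 'I_d)
      A (tnth u.1 p) u.2 * H (subst_idx u.1 p u.2) * K u.1.
  under eq_bigr => t _ do rewrite ffunE mulr_suml.
  rewrite exchange_big /=; apply: eq_bigr => p _.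
  rewrite -(pair_bigA _ (fun t j =>
    A (tnth t p) j * H (subst_idx t p j) * K t)) /=.
  by apply: eq_bigr => t _; rewrite mulr_suml.
rewrite dotE [RHS](eq_bigr (fun t => - (tensor_act A G t * F t))); last first.
  by move=> t _; rewrite mulrC.
rewrite sumrN dotE -sumrN; apply: eq_bigr => p _.
(* This involution exchanges the letter in slot [p] with the summation letter, hence transposes [A];
   antisymmetry then supplies the sign. *)
pose h (u : k.-tuple 'I_d * 'I_d) := (subst_idx u.1 p u.2, tnth u.1 p).
have hK : involutive h.
  by case=> t j; rewrite /h /= subst_idxK subst_idx_id tnth_mktuple eqxx.
rewrite (reindex_inj (inv_inj hK)) /= -sumrN; apply: eq_bigr => -[t j] _ /=.
rewrite subst_idxK subst_idx_id tnth_mktuple eqxx.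
have -> : A j (tnth t p) = - A (tnth t p) j.
  by move/matrixP/(_ (tnth t p) j): Aso; rewrite !mxE.
by rewrite mulNr mulNr mulrAC.
Qed.

Lemma dot_eq0 k (F : tensor R d k) : dot F F = 0 -> F = 0.
Proof.
move=> /eqP; rewrite psumr_eq0; last by move=> t _; rewrite -expr2 sqr_ge0.
move=> /allP F0; apply/ffunP => t; rewrite ffunE.
by have := F0 t (mem_index_enum _); rewrite /= mulf_eq0 orbb => /eqP.
Qed.

(** Each permutation can be moved from [F] to [G], where its sign cancels the one in [alt]; the k!
    equal terms absorb the normalization. *)
Lemma dot_alt k (F G : tensor R d k) : G \in @altspace R d k ->
  dot (alt F) G = dot F G.
Proof.
move=> /altspaceP altG; rewrite /dot.
under eq_bigr => t _ do rewrite ffunE -mulrA mulr_suml mulr_sumr.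
rewrite exchange_big /= (eq_bigr (fun=> k`!%:R^-1 * \sum_t F t * G t)).
  rewrite sumr_const card_Sn -[LHS]mulr_natl mulrA mulfV ?mul1r //.
  by rewrite pnatr_eq0 -lt0n fact_gt0.
move=> s _; rewrite mulr_sumr (reindex_inj (h := perm_idx s^-1)) /=.
  apply: eq_bigr => t _; rewrite perm_idxM mulgV.
  have -> : perm_idx 1 t = t.
    by apply: eq_from_tnth => p; rewrite tnth_mktuple perm1.
  by rewrite altG odd_permV mulrACA -expr2 sqrr_sign mul1r.
move=> t u /(congr1 (perm_idx s)); rewrite !perm_idxM mulgV => /eqP.
move=> /eqP e; apply: eq_from_tnth => p.
by have := congr1 (fun v => tnth v p) e; rewrite !tnth_mktuple !perm1.
Qed.

Lemma kform_actDl k a A B (F : kform R d k) :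
  kform_act (a *: A + B) F = a *: kform_act A F + kform_act B F.
Proof. by apply: val_inj; rewrite /= tensor_actDl. Qed.

Lemma kform_act_linear k A : linear (@kform_act R d k A).
Proof. by move=> a F G; apply: val_inj; rewrite /= tensor_actDr. Qed.

HB.instance Definition _ k A :=
  GRing.isLinear.Build R (kform R d k) (kform R d k) _ (@kform_act R d k A)
    (@kform_act_linear k A).

Lemma stabilizer_so_subalgebra k (F : kform R d k) :
  so_subalgebra (stabilizer F).
Proof.
have act0 : kform_act 0 F = 0.
  by have := kform_actDl (-1) 0 0 F; rewrite scaler0 addr0 scaleN1r addNr.
split.
- by move=> A /andP[].
- split; first by rewrite inE act0 inE trmx0 oppr0 !eqxx.
  move=> a A B /andP[/eqP Aso /eqP AF] /andP[/eqP Bso /eqP BF].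
  rewrite inE kform_actDl AF BF scaler0 addr0 eqxx andbT inE.
  by rewrite raddfD /= linearZ /= Aso Bso scalerN opprD.
- move=> A B /andP[/eqP Aso /eqP AF] /andP[/eqP Bso /eqP BF].
  rewrite inE; apply/andP; split.
    rewrite inE linearB /= !trmx_mul Aso Bso !mulNmx !mulmxN !opprK.
    by rewrite opprB.
  apply/eqP/val_inj; rewrite /= -tensor_act_comm.
  have E C D : tensor_act C (tensor_act D (vsval F)) =
      vsval (kform_act C (kform_act D F)) by [].
  by rewrite !E AF BF !linear0 addr0.
Qed.

Lemma stabilizer_invariant k (F : kform R d k) :
  invariant_form (stabilizer F) F.
Proof. by move=> A /andP[_ /eqP]. Qed.

End TensorAction.

(** * Integer combinations of components *)

Section Components.
Variables (R : realType) (d k : nat).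
Implicit Types (F G : kform R d k) (a b : 'I_d) (s : seq 'I_d).

(* Words of the wrong length have component 0. *)
Definition tcoord (T : tensor R d k) s : R := oapp T 0 (insub s).

Lemma tcoordE (T : tensor R d k) (t : k.-tuple 'I_d) : tcoord T t = T t.
Proof. by rewrite /tcoord valK. Qed.

Definition cmpt F s : R := tcoord (vsval F) s.

Lemma cmptE F (t : k.-tuple 'I_d) : cmpt F t = vsval F t.
Proof. exact: tcoordE. Qed.

Lemma cmpt_nil F s : size s != k -> cmpt F s = 0.
Proof. by move=> sk; rewrite /cmpt /tcoord insubF //; apply: negPf. Qed.

Lemma cmpt_inj F G : (forall t : k.-tuple 'I_d, cmpt F t = cmpt G t) -> F = G.
Proof.
by move=> eqFG; apply/val_inj/ffunP => t; have := eqFG t; rewrite !cmptE.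
Qed.

Lemma cmpt_swap F s1 a b s2 :
  cmpt F (s1 ++ a :: b :: s2) = - cmpt F (s1 ++ b :: a :: s2).
Proof.
have [sk|sk] := eqVneq (size (s1 ++ a :: b :: s2)) k; last first.
  rewrite !cmpt_nil ?oppr0 //; by move: sk; rewrite !size_cat.
have /altspaceP altF := valP F.
have sk' : size (s1 ++ b :: a :: s2) == k by rewrite -sk !size_cat.
have ltk : ((size s1).+1 < k)%N.
  by rewrite -sk size_cat /= !addnS !ltnS leq_addr.
pose p := Ordinal (ltnW ltk); pose q := Ordinal ltk.
have npq : p != q by apply/eqP => /(congr1 val)/eqP; rewrite /= ltn_eqF.
pose t : k.-tuple 'I_d := Tuple sk'.
have et : s1 ++ a :: b :: s2 = perm_idx (tperm p q) t.
  apply: (@eq_from_nth _ a) => [|i]; rewrite ?size_tuple // sk => ik.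
  rewrite -[RHS](tnth_nth a _ (Ordinal ik)) tnth_mktuple (tnth_nth a) /=.
  case: tpermP => [/(congr1 val)/= ->|/(congr1 val)/= ->|].
  1,2: rewrite !nth_cat /= ltnn subnn [(_.+1 < _)%N]ltnNge leqnSn.
  1,2: by rewrite subSn // subnn.
  move=> /eqP + /eqP; rewrite -!val_eqE /= => ip iq; rewrite !nth_cat.
  case: ltngtP ip => // ip _; case def_i: (i - size s1)%N => [|[|n]] //.
    by move: ip; rewrite -subn_gt0 def_i.
  by move: iq; rewrite -[i](subnK (ltnW ip)) def_i add1n eqxx.
by rewrite et cmptE altF odd_tperm npq expr1 mulN1r -(cmptE F t).
Qed.

Lemma cmpt_dup F s1 a s2 : cmpt F (s1 ++ a :: a :: s2) = 0.
Proof.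
by apply/eqP; rewrite -[_ == 0](mulrn_eq0 _ 2) mulr2n {2}cmpt_swap subrr.
Qed.

(* The sign is 0 if a letter is repeated. *)
Fixpoint sinsert a s : int * seq 'I_d :=
  if s is b :: s' then
    if (a < b)%N then (1, a :: s) else
    if a == b then (0, a :: s) else
    let: (c, r) := sinsert a s' in (- c, b :: r)
  else (1, [:: a]).

Fixpoint ssort s : int * seq 'I_d :=
  if s is a :: s' then
    let: (c, r) := ssort s' in let: (c', r') := sinsert a r in (c * c', r')
  else (1, [::]).

Lemma cmpt_sinsert F s1 a s :
  cmpt F (s1 ++ a :: s) = (sinsert a s).1%:~R * cmpt F (s1 ++ (sinsert a s).2).
Proof.
elim: s s1 => [|b s IHs] s1 /=; first by rewrite mul1r.
case: ifP => _ /=; first by rewrite mul1r.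
case: eqP => [<-|_] /=; first by rewrite cmpt_dup mul0r.
case def_r: sinsert (IHs (rcons s1 b)) => [c r] /=; rewrite !cat_rcons => IH.
by rewrite cmpt_swap IH rmorphN mulNr.
Qed.

Lemma cmpt_cat_ssort F s1 s :
  cmpt F (s1 ++ s) = (ssort s).1%:~R * cmpt F (s1 ++ (ssort s).2).
Proof.
elim: s s1 => [|a s IHs] s1 /=; first by rewrite mul1r.
case: ssort (IHs (rcons s1 a)) => [c r] /=; rewrite !cat_rcons => ->.
by rewrite cmpt_sinsert; case: sinsert => c' r' /=; rewrite rmorphM mulrA.
Qed.

Lemma cmpt_ssort F s : cmpt F s = (ssort s).1%:~R * cmpt F (ssort s).2.
Proof. exact: (cmpt_cat_ssort F [::]). Qed.

(* Formal combinations of components, seen as linear functionals by ev. *)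
Definition comb := seq (int * seq 'I_d).
Implicit Types (l m : comb).

Definition ev F l : R := \sum_(e <- l) e.1%:~R * cmpt F e.2.

Lemma ev1 F s : ev F [:: (1, s)] = cmpt F s.
Proof. by rewrite /ev big_seq1 mul1r. Qed.

Lemma ev_cat F l m : ev F (l ++ m) = ev F l + ev F m.
Proof. exact: big_cat. Qed.

Lemma evP (a : R) F G l : ev (a *: F + G) l = a * ev F l + ev G l.
Proof.
rewrite mulr_sumr -big_split /=; apply: eq_bigr => e _.
rewrite /cmpt /tcoord; case: insubP => [t _ _|_] /=.
  by rewrite !ffunE mulrDr mulrCA.
by rewrite !mulr0 addr0.
Qed.

Lemma ev0 l : ev 0 l = 0.
Proof. by have := evP (-1) 0 0 l; rewrite scaler0 addr0 mulN1r addNr. Qed.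

Lemma evZ (a : R) F l : ev (a *: F) l = a * ev F l.
Proof. by rewrite -[a *: F]addr0 evP ev0 addr0. Qed.

Lemma evD F G l : ev (F + G) l = ev F l + ev G l.
Proof. by rewrite -[F]scale1r evP mul1r scale1r. Qed.

Lemma ev_sum (I : Type) (r : seq I) (P : pred I) (G : I -> kform R d k) l :
  ev (\sum_(i <- r | P i) G i) l = \sum_(i <- r | P i) ev (G i) l.
Proof.
exact: (big_morph (fun F => ev F l) (fun F G => evD F G l) (ev0 l)).
Qed.

Definition scalec (c : int) l : comb := [seq (c * e.1, e.2) | e <- l].

Lemma ev_scale F c l : ev F (scalec c l) = c%:~R * ev F l.
Proof.
rewrite /ev big_map mulr_sumr; apply: eq_bigr => e _.
by rewrite rmorphM mulrA.
Qed.

Fixpoint add_term (e : int * seq 'I_d) l : comb :=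
  if l is e' :: l' then
    if e.2 == e'.2 then (e.1 + e'.1, e.2) :: l' else e' :: add_term e l'
  else [:: e].

Lemma ev_add_term F e l : ev F (add_term e l) = e.1%:~R * cmpt F e.2 + ev F l.
Proof.
rewrite /ev; elim: l => [|e' l IHl] /=; first by rewrite big_seq1 big_nil addr0.
case: eqP => [eq_e|_]; rewrite !big_cons ?IHl.
  by rewrite rmorphD mulrDl /= eq_e addrA.
by rewrite addrCA.
Qed.

Definition norm l : comb :=
  [seq e <- foldr (fun e l' => let: (c, r) := ssort e.2 in
     let c' := e.1 * c in if c' == 0 then l' else add_term (c', r) l') [::] l
     | e.1 != 0].

Lemma ev_norm F l : ev F (norm l) = ev F l.
Proof.
rewrite /norm {1}/ev big_filter big_mkcond /=.
rewrite (eq_bigr (fun e => e.1%:~R * cmpt F e.2)) => [|e _]; last first.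
  by case: eqP => // ->; rewrite mul0r.
elim: l => [|e l IHl] /=; first by rewrite [RHS]big_nil big_nil.
rewrite [RHS]big_cons cmpt_ssort; case: ssort => [c r] /=.
rewrite mulrA -rmorphM /=; case: eqP => [->|_].
  by rewrite mul0r add0r.
by rewrite -[X in _ + X]/(ev F l) -IHl -/(ev F _) ev_add_term.
Qed.

(** A sound test by computation: an empty normal form of the difference forces equal values on every
    form, by antisymmetry alone. *)
Definition same_comb l m := norm (l ++ scalec (-1) m) == [::].

Lemma ev_same_comb F l m : same_comb l m -> ev F l = ev F m.
Proof.
move=> /eqP lm0; have: ev F (norm (l ++ scalec (-1) m)) = 0.
  by rewrite lm0 /ev big_nil.
by rewrite ev_norm ev_cat ev_scale mulN1r => /eqP; rewrite subr_eq0 => /eqP.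
Qed.

End Components.

(** * Three-forms *)

Section ThreeForms.
Variables (R : realType) (d : nat).
Implicit Types (F : kform R d 3) (s : seq 'I_d) (l m : comb d).

Definition perms3 s : comb d :=
  if s is [:: a; b; c] then
    [:: (1, [:: a; b; c]); (1, [:: b; c; a]); (1, [:: c; a; b]);
        (-1, [:: b; a; c]); (-1, [:: a; c; b]); (-1, [:: c; b; a])]
  else [::].

Lemma sum_S3 (G : 'S_3 -> R) (i0 := ord0 : 'I_3) (i1 := lift ord0 ord0 : 'I_3)
    (i2 := ord_max : 'I_3) :
  \sum_s G s =
  \sum_(s <- [:: 1%g; (tperm i0 i1 * tperm i0 i2)%g;
              (tperm i0 i2 * tperm i0 i1)%g; tperm i0 i1; tperm i1 i2;
              tperm i0 i2]) G s.
Proof.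
set ps := (X in _ = \sum_(s <- X) _).
have ups : uniq ps.
  pose vals (s : 'S_3) := [seq val (s i) | i <- [:: i0; i1; i2]].
  apply: (@map_uniq _ _ vals).
  by rewrite /vals /= !permM !perm1 /tperm !permE.
rewrite [RHS]big_uniq //=; apply: eq_bigl => s; symmetry.
(* Six distinct elements exhaust a group of order 3! = 6. *)
have /subset_leqif_card[_] : ps \subset [set: 'S_3] by apply/subsetP.
rewrite cardsT card_Sn (card_uniqP ups) eqxx => /esym/subsetP; apply.
by rewrite inE.
Qed.

Lemma alt3E (T : tensor R d 3) (t : 3.-tuple 'I_d) :
  6 * alt T t = \sum_(e <- perms3 t) e.1%:~R * tcoord T e.2.
Proof.
rewrite ffunE mulrA mulfV ?mul1r ?pnatr_eq0 // sum_S3.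
case/tupleP: t => a t; case/tupleP: t => b t; case/tupleP: t => c t.
rewrite (tuple0 t) /= !big_cons !big_nil.
pose I3 := [:: ord0 : 'I_3; lift ord0 ord0; ord_max].
have E (s : 'S_3) (u : 3.-tuple 'I_d) :
    [seq tnth [tuple a; b; c] (s p) | p <- I3] = u ->
    T (perm_idx s [tuple a; b; c]) = tcoord T u.
  move=> eu; rewrite tcoordE; congr (T _); apply: val_inj; rewrite /= -eu.
  have <- : enum 'I_3 = I3 by apply: (inj_map val_inj); rewrite val_enum_ord.
  by [].
congr (_ * _ + (_ * _ + (_ * _ + (_ * _ + (_ * _ + (_ * _ + _)))))).
all: rewrite ?odd_permM ?odd_tperm ?odd_perm1 //=.
all: apply: (E _ [tuple _; _; _]).
all: by rewrite /= ?permM ?perm1 /tperm ?permE /= ?permE.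
Qed.

Definition delta s l : int :=
  foldr +%R 0 [seq e.1 * e'.1 * (e.2 == e'.2)%:R | e <- perms3 s, e' <- l].

(* The form dual to l for the inner product <F, G> = 1/6 sum_t F_t G_t; delta
   computes its components. *)
Definition comb_form l : kform R d 3 :=
  Subvs (alt_in [ffun t : 3.-tuple 'I_d =>
    6 * \sum_(e <- l) e.1%:~R * (tval t == e.2)%:R : R^o]).

Lemma cmpt_comb_form l s : cmpt (comb_form l) s = (delta s l)%:~R.
Proof.
have [/eqP sk|sk] := eqVneq (size s) 3; last first.
  by rewrite cmpt_nil // /delta; case: s sk => [|a [|b [|c [|e s]]]].
have six_neq0 : (6 : R) != 0 by rewrite pnatr_eq0.
rewrite -[s]/(tval (Tuple sk)) cmptE; apply: (mulfI six_neq0).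
rewrite alt3E /delta foldrE big_allpairs_dep raddf_sum mulr_sumr /=.
case: s {sk}(eqP sk) => [|a [|b [|c [|e s]]]] //= _.
rewrite !big_cons !big_nil.
have tE a' b' c' (T : tensor R d 3) :
  tcoord T [:: a'; b'; c'] = T [tuple a'; b'; c'] by apply: tcoordE.
rewrite !tE !ffunE /= !raddf_sum !mulr_sumr.
congr (_ + (_ + (_ + (_ + (_ + (_ + _)))))).
all: apply: eq_bigr => e _.
all: by rewrite /= !intrM mulrCA !mulrA; case: (_ == _).
Qed.

Lemma dot_comb_form l F : dot (vsval (comb_form l)) (vsval F) = 6 * ev F l.
Proof.
rewrite dot_alt ?subvsP // /dot /ev mulr_sumr.
under eq_bigr => t _ do rewrite ffunE -mulrA mulr_suml mulr_sumr.
rewrite exchange_big /=; apply: eq_bigr => e _.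
rewrite /cmpt /tcoord; case: insubP => [t _ et|ne] /=; last first.
  rewrite !mulr0 big1 // => t _; case: eqP => [et|_].
    by rewrite -et size_tuple eqxx in ne.
  by rewrite mulr0 mul0r mulr0.
rewrite (bigD1 t) //= et eqxx mulr1 big1 ?addr0 // => u nut.
by rewrite -et (inj_eq val_inj) (negPf nut) mulr0 mul0r mulr0.
Qed.

Lemma tcoord3 (T : tensor R d 3) a b c :
  tcoord T [:: a; b; c] = T [tuple a; b; c].
Proof. exact: tcoordE T [tuple a; b; c]. Qed.

Lemma cmpt_duality_op (Om : kform R d 4) F a b c :
  6 * cmpt (duality_op Om F) [:: a; b; c] =
  \sum_(e <- perms3 [:: a; b; c]) e.1%:~R * \sum_i \sum_j
    cmpt Om [:: i, j & take 2 e.2] * cmpt F [:: i, j & drop 2 e.2].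
Proof.
rewrite (cmptE _ [tuple a; b; c]) duality_opE alt3E /= !big_cons !big_nil /=.
have E a' b' c' : tcoord (contraction Om F) [:: a'; b'; c'] =
    \sum_i \sum_j cmpt Om [:: i; j; a'; b'] * cmpt F [:: i; j; c'].
  rewrite tcoord3 ffunE; apply: eq_bigr => i _; apply: eq_bigr => j _.
  by rewrite (cmptE Om [tuple i; j; a'; b']) (cmptE F [tuple i; j; c']).
by rewrite !E.
Qed.

Lemma sum_tuple3 (G : 3.-tuple 'I_d -> R) :
  \sum_u G u = \sum_i \sum_j \sum_n G [tuple i; j; n].
Proof.
pose h (p : 'I_d * 'I_d * 'I_d) := [tuple p.1.1; p.1.2; p.2].
pose g (u : 3.-tuple 'I_d) := (tnth u 0, tnth u 1, tnth u 2%:R).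
have hK : cancel h g by case=> -[].
have gK : cancel g h.
  by move=> u; apply: eq_from_tnth => -[[|[|[|]]]] // lt3;
     rewrite (tnth_nth (tnth u 0)) /=; congr (tnth u _); apply: val_inj.
rewrite (reindex h) /=; last by exists g => u _; rewrite ?hK ?gK.
by rewrite !pair_bigA.
Qed.

(** The antisymmetrization of the upper indices is absorbed by [F], and the Kronecker delta then
    collapses the sum to the contraction. *)
Lemma duality_op_kernel (Om : kform R d 4) F (t : 3.-tuple 'I_d) :
  vsval (duality_op Om F) t = \sum_u duality_kernel Om t u * vsval F u.
Proof.
rewrite duality_opE /duality_kernel ffunE.
under [RHS]eq_bigr => u _ do rewrite ffunE -mulrA mulr_suml.
rewrite -mulr_sumr exchange_big /=; congr (_ * _); apply: eq_bigr => s _.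
under [RHS]eq_bigr => u _ do rewrite ffunE -mulrA.
rewrite -mulr_sumr; congr (_ * _).
move: {s t}(perm_idx s t) => t; set K := finfun _.
rewrite -[RHS]/(dot (alt K) (vsval F)) dot_alt ?subvsP // /dot sum_tuple3.
rewrite ffunE; apply: eq_bigr => i _; apply: eq_bigr => j _.
rewrite (bigD1 (tnth t 2%:R)) //= big1 ?addr0 => [|n nt]; last first.
  have nt' : (tnth t 2%:R == tnth [tuple i; j; n] 2%:R) = false.
    by rewrite eq_sym; apply: negPf.
  by rewrite ffunE nt' mulr0 mul0r.
have ntt : tnth t 2%:R == tnth [tuple i; j; tnth t 2%:R] 2%:R by [].
rewrite ffunE ntt mulr1; congr (_ * _).
(* Four adjacent transpositions, an even permutation, turn the index order [l m i j] of the kernel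
   into the order [i j l m] of the contraction. *)
move: (tnth t 0) (tnth t 1) => l m; rewrite -!cmptE /=.
rewrite (cmpt_swap _ [:: l] m i) (cmpt_swap _ [::] l i) opprK.
by rewrite (cmpt_swap _ [:: i; l] m j) (cmpt_swap _ [:: i] l j) opprK.
Qed.

End ThreeForms.
Arguments comb_form R {d} l.

Lemma cmpt_act (R : realType) d k A (F : kform R d k) (t : k.-tuple 'I_d) :
  cmpt (kform_act A F) t =
  \sum_(p < k) \sum_j A (tnth t p) j * cmpt F (subst_idx t p j).
Proof.
rewrite cmptE ffunE; apply: eq_bigr => p _; apply: eq_bigr => j _.
by rewrite cmptE.
Qed.

(** * Verified computations in dimension 8 *)

(* Unlike enum 'I_8 (locked) and insub (stuck on idP), this list computes. *)
Definition ords : seq 'I_8 := pmap (@insub_eq _ _ 'I_8) (iota 0 8).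

Lemma enum_ords : enum 'I_8 = ords.
Proof.
rewrite enumT unlock /= /ord_enum /ords.
by apply: eq_pmap => i; rewrite insub_eqE.
Qed.

Lemma sum_ords (V : nmodType) (G : 'I_8 -> V) :
  \sum_i G i = \sum_(i <- ords) G i.
Proof. by rewrite -enum_ords big_enum. Qed.

Lemma mem_ords i : i \in ords.
Proof. by rewrite -enum_ords mem_enum. Qed.

Definition words k : seq (seq 'I_8) :=
  iter k (fun L => [seq a :: s | a <- ords, s <- L]) [:: [::]].

Lemma mem_words k (t : k.-tuple 'I_8) : (t : seq 'I_8) \in words k.
Proof.
elim: k t => [|k IHk] t; first by rewrite tuple0.
by case/tupleP: t => a t; apply/allpairs_f; [apply: mem_ords | apply: IHk].
Qed.

Lemma size_words k s : s \in words k -> size s = k.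
Proof.
by elim: k s => [|k IHk] s; [case: s | case/allpairsP => -[a r] [_ /IHk <- ->]].
Qed.

(** The strictly increasing words, one per basis form: 56 for [k = 3] and 70 for [k = 4]. *)
Definition sorted_words k := [seq s <- words k | ssort s == (1, s)].

Definition triples := sorted_words 3.
Definition quadruples := sorted_words 4.

Lemma ssort_check k : (k == 3) || (k == 4) ->
  all (fun s => let: (c, r) := ssort s in
    (c == 0) || (ssort r == (1, r)) && (size r == k)) (words k).
Proof. by case/orP => /eqP ->; vm_compute. Qed.

Lemma ssort_sorted k (t : k.-tuple 'I_8) : (k == 3) || (k == 4) ->
  (ssort t).1 = 0 \/ (ssort t).2 \in sorted_words k.
Proof.
move=> /ssort_check/allP/(_ _ (mem_words t)); case: ssort => c r /=.
case/orP => [/eqP|/andP[r1 rk]]; [by left | right].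
by rewrite mem_filter r1 (mem_words (Tuple rk)).
Qed.

Lemma kform_eq (R : realType) k (F G : kform R 8 k) : (k == 3) || (k == 4) ->
  (forall s, s \in sorted_words k -> cmpt F s = cmpt G s) -> F = G.
Proof.
move=> k34 eqFG; apply: cmpt_inj => t; rewrite cmpt_ssort [RHS]cmpt_ssort.
by have [->|/eqFG->//] := ssort_sorted t k34; rewrite !mul0r.
Qed.

(** * The quads and the components of [Theta] *)

Definition quads : seq (seq 'I_8) :=
  [seq pmap (@insub_eq _ _ 'I_8) q | q <-
    [:: [:: 0; 1; 3; 4]; [:: 0; 1; 6; 5]; [:: 0; 2; 3; 5]; [:: 0; 2; 4; 6];
        [:: 1; 2; 4; 5]; [:: 1; 3; 2; 6]; [:: 3; 4; 5; 6]; [:: 0; 1; 2; 7];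
        [:: 3; 2; 4; 7]; [:: 3; 6; 0; 7]; [:: 4; 0; 5; 7]; [:: 4; 6; 1; 7];
        [:: 5; 1; 3; 7]; [:: 5; 6; 2; 7]]%N].

Lemma quadsE : quads = [seq val q | q <- theta_quads].
Proof.
apply: (inj_map (inj_map val_inj)); rewrite -[RHS]map_comp.
by rewrite -[RHS]/Defs.quads_nat Defs.quads_natE; vm_compute.
Qed.

Definition sorted_quads := map (@ssort 8) quads.

Definition quad_sign r : int :=
  foldr +%R 0 [seq if q.2 == r then q.1 else 0 | q <- sorted_quads].
Arguments quad_sign : simpl never.

Definition theta s : int := let: (c, r) := ssort s in c * quad_sign r.

Lemma theta_sorted : all (fun s =>
    has (fun q => [&& (ssort q).2 == s, quad_sign s == (ssort q).1
      & (ssort q).1 * quad_sign s == 1]) quads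
    || (quad_sign s == 0) && ~~ has (perm_eq s) quads) quadruples.
Proof. by vm_compute. Qed.

(** After sorting, [theta_sorted] leaves two cases: a quad, where [ThetaE] fixes the sign through
    the listed ordering, or none, where [Theta_eq0] applies. *)
Lemma cmpt_Theta (R : realType) (t : 4.-tuple 'I_8) :
  cmpt (Theta R) t = (theta t)%:~R.
Proof.
rewrite cmpt_ssort /theta; have [c0|] := ssort_sorted t isT.
  by case: ssort c0 => c r /= ->; rewrite !mul0r.
case: (ssort t) => c r /= sw; rewrite intrM; congr (_ * _).
have := sw; rewrite mem_filter => /andP[_ rw].
have /orP[] := allP theta_sorted _ sw.
  case/hasP => q; rewrite quadsE => /mapP[q' /(ThetaE R) Eq ->] /and3P[].
  move=> /eqP eq_s /eqP sign_q /eqP c1.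
  have: cmpt (Theta R) q' = 1 by rewrite cmptE.
  rewrite cmpt_ssort eq_s => e.
  transitivity (((ssort q').1 * quad_sign r)%:~R * cmpt (Theta R) r).
    by rewrite c1 mul1r.
  by rewrite intrM mulrAC e mul1r.
case/andP=> /eqP-> /hasPn nq.
have size_r : size r == 4 by rewrite (size_words rw).
rewrite -[r]/(val (Tuple size_r)) cmptE; apply: Theta_eq0.
apply/hasPn => q qP; apply: nq; rewrite quadsE; exact: map_f.
Qed.

(** * Generators of spin(7) *)

(** Cycling the last three letters is even, so the sign is kept, and it reaches all three splittings
    of the quad into two pairs. *)
Definition rotations (q : seq 'I_8) : seq (seq 'I_8) :=
  if q is [:: a; b; c; d] then
    [:: [:: a; b; c; d]; [:: a; c; d; b]; [:: a; d; b; c]]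
  else [::].

(* The generator E_ab + E_cd of spin(7) is encoded by the word abcd. *)
Definition gens := flatten (map rotations quads).

Definition gen_row (g : seq 'I_8) (i : 'I_8) : seq (int * 'I_8) :=
  if g is [:: a; b; c; d] then
    if i == a then [:: (1, b)] else if i == b then [:: (-1, a)] else
    if i == c then [:: (1, d)] else if i == d then [:: (-1, c)] else [::]
  else [::].

Definition gen_entry g i j : int :=
  foldr +%R 0 [seq if u.2 == j then u.1 else 0 | u <- gen_row g i].

Definition gen_mx (R : realType) g : 'M[R]_8 :=
  \matrix_(i, j) (gen_entry g i j)%:~R.

Lemma gen_mx_sum (R : realType) g i (f : 'I_8 -> R) :
  \sum_j gen_mx R g i j * f j = \sum_(u <- gen_row g i) u.1%:~R * f u.2.
Proof.
under eq_bigr => j _ do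
  rewrite mxE /gen_entry foldrE big_map raddf_sum mulr_suml.
rewrite exchange_big /=; apply: eq_bigr => u _.
rewrite (bigD1 u.2) //= eqxx big1 ?addr0 // => j nj.
by rewrite eq_sym (negPf nj) mul0r.
Qed.

Definition act_comb g (l : comb 8) : comb 8 :=
  flatten [seq [seq (e.1 * u.1, set_nth ord0 e.2 p u.2)
                  | p <- iota 0 (size e.2), u <- gen_row g (nth ord0 e.2 p)]
             | e <- l].

Lemma ev_act (R : realType) k (F : kform R 8 k) g l :
  ev (kform_act (gen_mx R g) F) l = ev F (act_comb g l).
Proof.
rewrite /ev big_flatten big_map; apply: eq_bigr => -[c s] _ /=.
rewrite big_allpairs_dep /=.
have [/eqP sk|sk] := eqVneq (size s) k; last first.
  rewrite cmpt_nil // mulr0 big_seq big1 // => p; rewrite mem_iota => /= lps.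
  rewrite big1 // => u _; rewrite cmpt_nil ?mulr0 //.
  by rewrite size_set_nth (maxn_idPr _).
rewrite -[s in LHS]/(tval (Tuple sk)) cmpt_act mulr_sumr.
rewrite (eqP sk) -[k in iota 0 k]subn0 -/(index_iota 0 k) big_mkord.
apply: eq_bigr => p _.
rewrite gen_mx_sum mulr_sumr (tnth_nth ord0); apply: eq_bigr => u _.
rewrite intrM -mulrA; congr (_ * (_ * cmpt F _)).
apply: (@eq_from_nth _ ord0) => [|i].
  by rewrite size_tuple size_set_nth (eqP sk) (maxn_idPr (ltn_ord p)).
rewrite size_tuple => ik; rewrite -[i]/(val (Ordinal ik)) -tnth_nth.
by rewrite tnth_mktuple nth_set_nth /= (tnth_nth ord0).
Qed.

Definition theta_ev (l : comb 8) : int :=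
  foldr +%R 0 [seq e.1 * theta e.2 | e <- l].

(** Antisymmetry of each generator, and vanishing of the 70 components of its action on [Theta]; the
    length condition makes [ev_Theta] applicable. *)
Lemma gens_check : all (fun g =>
    all (fun i => all (fun j => gen_entry g j i == - gen_entry g i j) ords) ords
    && all (fun s => let l := act_comb g [:: (1, s)] in
         all (fun e => size e.2 == 4) l && (theta_ev l == 0)) quadruples)
  gens.
Proof. by vm_compute. Qed.

Lemma ev_Theta (R : realType) l : all (fun e => size e.2 == 4) l ->
  ev (Theta R) l = (theta_ev l)%:~R.
Proof.
rewrite /theta_ev foldrE big_map raddf_sum /= /ev => /allP l4.
rewrite big_seq [RHS]big_seq; apply: eq_bigr => e /l4 e4.
by rewrite -[e.2]/(tval (Tuple e4)) cmpt_Theta intrM.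
Qed.

Lemma gen_mx_spin7 (R : realType) g : g \in gens -> gen_mx R g \in spin7 R.
Proof.
move=> /(allP gens_check)/andP[/allP so_g /allP act_g].
rewrite inE; apply/andP; split.
  apply/eqP/matrixP => i j; rewrite !mxE.
  have /allP/(_ j (mem_ords j))/eqP -> := so_g i (mem_ords i).
  by rewrite rmorphN.
apply/eqP/kform_eq => // s /act_g/andP[l4 /eqP act0].
by rewrite -!ev1 ev_act ev_Theta // act0 ev0.
Qed.

(* Elements of the enveloping algebra; op_comb is the transpose of op_act. *)
Inductive op :=
  | Gen of seq 'I_8 | Id | Add of op & op | Mul of op & op | Scale of int & op.

Fixpoint op_act (R : realType) k (P : op) (F : kform R 8 k) : kform R 8 k :=
  match P with
  | Gen g => kform_act (gen_mx R g) F
  | Id => F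
  | Add P1 P2 => op_act P1 F + op_act P2 F
  | Mul P1 P2 => op_act P1 (op_act P2 F)
  | Scale c P1 => c%:~R *: op_act P1 F
  end.

Fixpoint op_comb (P : op) (l : comb 8) : comb 8 :=
  match P with
  | Gen g => norm (act_comb g l)
  | Id => l
  | Add P1 P2 => norm (op_comb P1 l ++ op_comb P2 l)
  | Mul P1 P2 => op_comb P2 (op_comb P1 l)
  | Scale c P1 => scalec c (op_comb P1 l)
  end.

Fixpoint op_wf (P : op) : bool :=
  match P with
  | Gen g => g \in gens
  | Id => true
  | Add P1 P2 => op_wf P1 && op_wf P2
  | Mul P1 P2 => op_wf P1 && op_wf P2
  | Scale c P1 => op_wf P1
  end.

(* The coordinate of f_{m,Q}, where q is an ordering of Q. *)
Definition flag m (q : seq 'I_8) : int * seq 'I_8 :=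
  let t := [seq i <- q | i != m] in (theta (m :: t), t).

Definition through m := [seq q <- quads | m \in q].

(** One list in two roles: [ev] reads it as the functional s_m, [comb_form] turns it into the form
    v_m. *)
Definition theta_row m : comb 8 := map (flag m) (through m).

Definition quad_at m k := nth [::] (through m) k.

Definition flag_diff m k : comb 8 :=
  flag m (quad_at m 0) :: scalec (-1) [:: flag m (quad_at m k)].

Definition square_op g := Mul (Gen g) (Gen g).

(** On 3-forms X^2 has eigenvalues 0, -1, -4. The value -1 belongs to the basis forms with an odd
    number of letters in the quad; there the polynomial equals -3, elsewhere 0. *)
Definition quad_proj q := Mul (square_op q) (Add (square_op q) (Scale 4 Id)).

(* Any four quads through m have only m in common; this is 81 times the
   projection onto the span of the f_{m,Q}. *)
Definition block_proj m :=
  foldr Mul Id [seq quad_proj q | q <- take 4 (through m)].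

(* The Casimir operator sum X^2 is -49 + 4 sum_m v_m v_m^T on 3-forms. *)
Definition casimir49 := foldr Add (Scale 49 Id) (map square_op gens).

Definition projector8 m := Mul casimir49 (block_proj m).

(* q is the third quad containing q0 :&: qk and r is its complement.  For each
   of the partitions of r in two pairs, X^2 acts on the f_{m,Q} as the sum over
   two pairs {Q, Q'} of quads through m of
   -2 (f_{m,Q} - f_{m,Q'}) (f_{m,Q} - f_{m,Q'})^T; the signed sum of the three
   squares cancels all but {q0, qk}. *)
Definition projector48 m k :=
  let q0 := quad_at m 0 in let qk := quad_at m k in
  let q := head [::] [seq q <- through m | [&& q != q0, q != qk &
                        has (fun p => [&& p != m, p \in q0 & p \in qk]) q]] in
  let r := head [::] [seq r <- quads | ~~ has (mem q) r] in
  let sign g := if (nth ord0 g 0 \in q0) == (nth ord0 g 1 \in q0)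
                then -1 else 1 in
  let s := [seq Scale (sign g) (square_op g) | g <- rotations r] in
  Mul (foldr Add (Scale 0 Id) s) (block_proj m).

(** Certifies on the 56 basis components that [P] acts as c l l^T, with [l] both as functional and
    as form. *)
Definition rank1 P c l := op_wf P && all (fun s =>
    same_comb (op_comb P [:: (1, s)]) (scalec (c * delta s l) l)) triples.

Definition idx48 := [seq (m, k) | m <- ords, k <- iota 1 6].

(** 324 = 4 * 81: [casimir49] contributes the 4 and [block_proj] the 81, while isolating the summand
    of v_m. *)
Lemma projector8_rank1 :
  all (fun m => rank1 (projector8 m) 324 (theta_row m)) ords.
Proof. by vm_compute. Qed.

(** -324 = -4 * 81: each square is -2 times the sum of two of three rank-one terms, so the signed
    sum leaves -4 times the chosen one; [block_proj] gives 81. *)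
Lemma projector48_rank1 :
  all (fun p => rank1 (projector48 p.1 p.2) (-324) (flag_diff p.1 p.2)) idx48.
Proof. by vm_compute. Qed.

(** * Inner products and connectivity of the spanning vectors *)

Definition pairc (l m : comb 8) : int :=
  foldr +%R 0 [seq e.1 * delta e.2 l | e <- m].

Definition link l m :=
  (pairc l m != 0)
  || has (fun g => pairc l (norm (act_comb g m)) != 0) gens.

(* Connectivity under the generators; every block is compared with the first
   one only. *)
Definition linked (bs : seq (seq (comb 8))) :=
  let b0 := head [::] bs in
  all (fun b => [&& all (fun l => all (fun l' => pairc l l' != 0) b) b,
    has (fun l => has (link l) b) b0 & has (fun l => has (link l) b0) b]) bs.

Lemma theta_row_linked : linked [seq [:: theta_row m] | m <- ords].
Proof. by vm_compute. Qed.

Lemma flag_diff_linked :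
  linked [seq [seq flag_diff m k | k <- iota 1 6] | m <- ords].
Proof. by vm_compute. Qed.

Lemma pair_theta_row : all (fun m => all (fun m' =>
  pairc (theta_row m) (theta_row m') == (m == m')%:R * 7) ords) ords.
Proof. by vm_compute. Qed.

Lemma pair_flag_diff_row : all (fun p => all (fun m =>
  pairc (flag_diff p.1 p.2) (theta_row m) == 0) ords) idx48.
Proof. by vm_compute. Qed.

(** For k from 1 to 6 these coordinates are dual, up to the sign -1, to the differences n_{m,k}. *)
Definition flag48 p := [:: flag p.1 (quad_at p.1 p.2)].

Lemma pair_flag_diff_dual : all (fun p => all (fun q =>
  pairc (flag_diff p.1 p.2) (flag48 q) == - (p == q)%:R) idx48) idx48.
Proof. by vm_compute. Qed.

Definition op_comb_duality s : comb 8 :=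
  flatten [seq [seq (e.1 * theta (i :: j :: take 2 e.2), i :: j :: drop 2 e.2)
                  | i <- ords, j <- ords]
             | e <- perms3 s].

(** The integral identity 6 b F = 4 F - 4 sum_m s_m(F) v_m, read on components. *)
Lemma duality_check : all (fun s => same_comb (op_comb_duality s)
    ((4, s) :: flatten [seq scalec (-4 * delta s (theta_row m)) (theta_row m)
                          | m <- ords]))
  triples.
Proof. by vm_compute. Qed.

Lemma expansion_check : all (fun s => same_comb [:: (1, s)]
    (flatten [seq scalec (delta s (flag48 (m, 0))) (theta_row m) | m <- ords]
     ++ flatten [seq scalec (- delta s (flag_diff p.1 p.2)) (flag48 p)
                   | p <- idx48]))
  triples.
Proof. by vm_compute. Qed.

Lemma theta_row_check : all (fun s => all (fun m =>
  delta s (theta_row m) == theta (m :: s)) ords) triples.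
Proof. by vm_compute. Qed.

(** * Decomposition into irreducible submodules *)

Lemma span_ind (K : fieldType) (V : vectType K) (X : seq V) (P : V -> Prop) :
  P 0 -> (forall a u v, P u -> P v -> P (a *: u + v)) ->
  {in X, forall x, P x} -> {in <<X>>%VS, forall v, P v}.
Proof.
move=> P0 PD PX v; rewrite -[X]/(tval (in_tuple X)) => /coord_span ->.
elim/big_rec: _ => // i u _ Pu; apply: PD => //; apply: PX.
by rewrite mem_nth ?size_tuple.
Qed.

Lemma subst_idx_cons0 k d (m : 'I_d) (t : k.-tuple 'I_d) j :
  subst_idx [tuple of m :: t] ord0 j = [tuple of j :: t].
Proof.
apply: eq_from_tnth => q; rewrite tnth_mktuple.
by case: (unliftP ord0 q) => [i|] ->; rewrite ?tnth0 ?tnthS.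
Qed.

Lemma subst_idx_consS k d (m : 'I_d) (t : k.-tuple 'I_d) p j :
  subst_idx [tuple of m :: t] (lift ord0 p) j = [tuple of m :: subst_idx t p j].
Proof.
apply: eq_from_tnth => q; rewrite tnth_mktuple.
case: (unliftP ord0 q) => [i|] ->; rewrite ?tnth0 ?tnthS ?tnth_mktuple //.
Qed.

Lemma num_irreducibles2 (R : realType) d k (h : {pred 'M[R]_d})
    (W1 W2 : {vspace kform R d k}) :
  irreducible h W1 -> irreducible h W2 -> (W1 + W2)%VS = fullv ->
  (W1 :&: W2)%VS = 0%VS -> num_irreducibles h k 2.
Proof.
move=> irr1 irr2 sumW capW.
exists (fun i : 'I_2 => if i == ord0 then W1 else W2).
have sumE : (\sum_(i < 2) if i == ord0 then W1 else W2)%VS = fullv.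
  by rewrite !big_ord_recl big_ord0 addv0 -sumW.
split=> //; first by case=> -[|[|]].
apply/directvP; rewrite /= sumE !big_ord_recl big_ord0 /= addn0.
by rewrite -sumW dimv_disjoint_sum.
Qed.

Section Irreducibility.
Variable R : realType.
Implicit Types (F : kform R 8 3) (l : comb 8) (U W : {vspace kform R 8 3}).

Lemma ev_comb_form l m : ev (comb_form R l) m = (pairc l m)%:~R.
Proof.
rewrite /pairc foldrE big_map raddf_sum; apply: eq_bigr => e _ /=.
by rewrite cmpt_comb_form intrM.
Qed.

Lemma ev_op P F l : ev (op_act P F) l = ev F (op_comb P l).
Proof.
elim: P F l => [g||P IHP Q IHQ|P IHP Q IHQ|c P IHP] F l //=.
- by rewrite ev_norm ev_act.
- by rewrite evD ev_norm ev_cat IHP IHQ.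
- by rewrite IHP IHQ.
- by rewrite evZ ev_scale IHP.
Qed.

Lemma op_submodule P U F :
  op_wf P -> submodule (spin7 R) U -> F \in U -> op_act P F \in U.
Proof.
move=> wfP subU; elim: P wfP F => [g||P IHP Q IHQ|P IHP Q IHQ|c P IHP] //=.
- by move=> /(gen_mx_spin7 R)/subU; apply.
- by move=> /andP[/IHP PU /IHQ QU] F FU; rewrite rpredD ?PU ?QU.
- by move=> /andP[/IHP PU /IHQ QU] F FU; rewrite PU ?QU.
- by move=> /IHP PU F FU; rewrite rpredZ ?PU.
Qed.

Lemma op_rank1 P c l F :
  rank1 P c l -> op_act P F = (c%:~R * ev F l) *: comb_form R l.
Proof.
case/andP=> _ /allP Pc; apply: kform_eq => // s /Pc/(ev_same_comb F).
rewrite -ev1 ev_op => ->; rewrite -[RHS]ev1 evZ ev_comb_form ev_scale.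
by rewrite /pairc /= addr0 mul1r intrM mulrAC.
Qed.

(** [P] preserves [U] and sends [F] to a nonzero multiple of the form of [l]. *)
Lemma form_sub U P c l F : submodule (spin7 R) U -> rank1 P c l -> c != 0 ->
  F \in U -> ev F l != 0 -> comb_form R l \in U.
Proof.
move=> subU Pl c0 FU Fl; have /andP[wfP _] := Pl.
have := op_submodule wfP subU FU; rewrite (op_rank1 F Pl) rpredZeq.
by rewrite mulf_eq0 intr_eq0 (negPf c0) (negPf Fl).
Qed.

Lemma link_sub U P c l m : submodule (spin7 R) U -> rank1 P c m -> c != 0 ->
  comb_form R l \in U -> link l m -> comb_form R m \in U.
Proof.
move=> subU Pm c0 lU /orP[lm|/hasP[g gG lm]].
  by apply: (form_sub subU Pm c0 lU); rewrite ev_comb_form intr_eq0.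
apply: (form_sub subU Pm c0 (subU _ _ (gen_mx_spin7 R gG) lU)).
by rewrite ev_act -ev_norm ev_comb_form intr_eq0.
Qed.

(** A nonzero submodule of [W] is not orthogonal to all spanning forms, so it contains one of them
    by rank-one projection; links then bring in all the others. *)
Lemma irreducible_linked (bs : seq (seq (comb 8))) W :
  submodule (spin7 R) W -> W = <<map (comb_form R) (flatten bs)>>%VS ->
  (forall l, l \in flatten bs -> exists P (c : int), rank1 P c l /\ c != 0) ->
  linked bs -> flatten bs != [::] -> irreducible (spin7 R) W.
Proof.
move=> subW defW rk1 /allP lkd bs0; split=> //.
  case def_l: (flatten bs) bs0 => [//|l ls] _.
  have lbs: l \in flatten bs by rewrite def_l mem_head.
  have /flattenP[b /lkd/and3P[/allP/(_ l) + _ _] lb] := lbs.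
  move=> /(_ lb)/allP/(_ l lb) ll; apply: contraNneq ll => W0.
  have: comb_form R l \in W by rewrite defW memv_span // map_f.
  rewrite W0 memv0 => /eqP l0.
  by have := ev_comb_form l l; rewrite l0 ev0 => /esym/eqP; rewrite intr_eq0.
move=> U subU UW; have [->|U0] := eqVneq U 0%VS; [by left | right].
have step F l :
    F \in U -> l \in flatten bs -> ev F l != 0 -> comb_form R l \in U.
  by move=> FU /rk1[P [c [Pl c0]]]; apply: (form_sub subU Pl c0 FU).
have link_step l m : comb_form R l \in U -> m \in flatten bs -> link l m ->
    comb_form R m \in U.
  by move=> lU /rk1[P [c [Pm c0]]]; apply: (link_sub subU Pm c0 lU).
have [l lbs lU] : exists2 l, l \in flatten bs & comb_form R l \in U.
  have uU : vpick U \in U by apply: memv_pick.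
  suff /hasP[l lbs] : has (fun l => ev (vpick U) l != 0) (flatten bs).
    by exists l => //; apply: step uU lbs _.
  (* Otherwise the picked vector is orthogonal to the span [W], hence to itself. *)
  apply: contraNT U0 => /hasPn nl; rewrite -vpick0; apply/eqP/val_inj.
  apply: dot_eq0; have: vpick U \in W by apply: (subvP UW).
  rewrite defW; move: (vpick U) nl => u nl uX.
  apply: (span_ind (P := fun v => dot (vsval v) (vsval u) = 0)) uX.
  - exact: dot0.
  - by move=> a F G F0 G0; rewrite [vsval _]linearP dotP F0 G0 mulr0 addr0.
  - move=> _ /mapP[l /nl/negPn/eqP l0 ->].
    by rewrite dot_comb_form l0 mulr0.
apply/eqP; rewrite eqEsubv UW defW /=.
apply/span_subvP => _ /mapP[m mbs ->].
have inbs b l1 : b \in bs -> l1 \in b -> l1 \in flatten bs.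
  by move=> bbs lb; apply/flattenP; exists b.
have same b l1 l2 : b \in bs -> l1 \in b -> l2 \in b ->
    comb_form R l1 \in U -> comb_form R l2 \in U.
  move=> bbs l1b l2b l1U; apply: link_step l1U (inbs _ _ bbs l2b) _.
  have /and3P[/allP/(_ _ l1b)/allP/(_ _ l2b) l12 _ _] := lkd _ bbs.
  by rewrite /link l12.
have hbs : head [::] bs \in bs.
  by move: bs0; case: (bs) => //= b bs' _; rewrite mem_head.
have /flattenP[b bbs lb] := lbs; have /flattenP[b' b'bs mb'] := mbs.
have /and3P[_ _ /hasP[l1 l1b /hasP[l2 l2h l12]]] := lkd _ bbs.
have /and3P[_ /hasP[m1 m1h /hasP[m2 m2b' m12]] _] := lkd _ b'bs.
(* The path, built backwards, is [l], [l1] in block [b], [l2] and [m1] in the first block, [m2] and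
   [m] in block [b']. *)
apply: (same b' m2) => //; apply: (link_step m1 m2 _ (inbs _ _ b'bs m2b') m12).
apply: (same _ l2 _ hbs) => //.
apply: (link_step l1 l2 _ (inbs _ _ hbs l2h) l12).
exact: (same b l).
Qed.

(** Evaluating a linear relation on [d j] isolates its j-th coefficient, so the vectors are free. *)
Lemma dim_dual (I : eqType) (r : seq I) (v : I -> kform R 8 3)
    (d : I -> comb 8) (c : R) : c != 0 -> uniq r ->
  {in r &, forall i j, ev (v i) (d j) = (i == j)%:R * c} ->
  \dim <<map v r>> = size r.
Proof.
move=> c0 ur vd; rewrite -(size_map v); apply/eqP.
rewrite -[_ == _]/(free (in_tuple _)); apply/freeP => k k0 j.
have [i0 _] : exists i, i \in r.
  by case: (r) j => [[]//|i ? _]; exists i; rewrite mem_head.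
have lt_r (i : 'I_(size (map v r))) : (i < size r)%N by rewrite -(size_map v).
have := congr1 (fun F => ev F (d (nth i0 r j))) k0.
rewrite /= ev0 ev_sum (bigD1 j) //= big1 ?addr0 => [|i nij].
  rewrite evZ (nth_map i0) // vd ?mem_nth // eqxx mul1r => /eqP.
  by rewrite mulf_eq0 (negPf c0) orbF => /eqP.
rewrite evZ (nth_map i0) // vd ?mem_nth // nth_uniq //.
by rewrite val_eqE (negPf nij) mul0r mulr0.
Qed.

Local Notation v m := (comb_form R (theta_row m)).
Local Notation b := (duality_op (Theta R)).

Lemma ev_duality_op s F : size s = 3 ->
  6 * cmpt (b F) s = ev F (op_comb_duality s).
Proof.
case: s => [|a [|a' [|a'' [|? ?]]]] // _.
rewrite cmpt_duality_op /ev /op_comb_duality big_flatten big_map.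
rewrite !big_seq; apply: eq_bigr => e.
have : all (fun e => size e.2 == 3) (perms3 [:: a; a'; a'']) by [].
move=> /allP/[apply]; case: e => c [|i1 [|i2 [|i3 [|? ?]]]] // _.
rewrite big_allpairs_dep mulr_sumr sum_ords; apply: eq_bigr => i _.
rewrite mulr_sumr sum_ords; apply: eq_bigr => j _.
rewrite [take _ _]/= [drop _ _]/= (cmpt_Theta R [tuple i; j; i1; i2]).
by rewrite intrM mulrA.
Qed.

Lemma ev_flatten (I : Type) (r : seq I) (g : I -> comb 8) F :
  ev F (flatten (map g r)) = \sum_(i <- r) ev F (g i).
Proof. by rewrite /ev big_flatten big_map. Qed.

Lemma duality_op_decomp F :
  b F = (2 / 3) *: (F - \sum_m ev F (theta_row m) *: v m).
Proof.
apply: kform_eq => // s sT; have /(ev_same_comb F) e := allP duality_check _ sT.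
have size_s : size s = 3.
  by move: sT; rewrite mem_filter => /andP[_ /size_words].
have six0 : (6 : R) != 0 by rewrite pnatr_eq0.
apply: (mulfI six0); rewrite ev_duality_op // e -cat1s ev_cat ev_flatten.
have -> : ev F [:: (4, s)] = 4 * cmpt F s by rewrite /ev big_seq1.
rewrite -[in RHS]ev1 evZ evD -scaleN1r evZ ev1 ev_sum sum_ords.
have -> : \sum_(m <- ords)
      ev F (scalec (-4 * delta s (theta_row m)) (theta_row m)) =
    - 4 * \sum_(m <- ords) ev F (theta_row m) * (delta s (theta_row m))%:~R.
  rewrite mulr_sumr; apply: eq_bigr => m _.
  by rewrite ev_scale intrM -mulrA [_ * ev _ _]mulrC.
under [X in _ = _ * (_ * (_ + _ * X))]eq_bigr => m _ do
  rewrite evZ ev1 cmpt_comb_form.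
by field.
Qed.

Lemma ev_theta_row m m' : ev (v m) (theta_row m') = (m == m')%:R * 7.
Proof.
rewrite ev_comb_form; have /allP/(_ _ (mem_ords m)) := pair_theta_row.
by move=> /allP/(_ _ (mem_ords m'))/eqP->; rewrite intrM; case: (m == m').
Qed.

Lemma duality_theta_row m : b (v m) = (- 4) *: v m.
Proof.
rewrite duality_op_decomp (bigD1 m) //= ev_theta_row eqxx.
rewrite big1 ?addr0 => [|m' nm].
  rewrite mul1r -{1}[v m]scale1r -scalerBl scalerA; congr (_ *: _); by field.
by rewrite ev_theta_row eq_sym (negPf nm) mul0r scale0r.
Qed.

Lemma duality_flag_diff p : p \in idx48 ->
  b (comb_form R (flag_diff p.1 p.2)) =
  (2 / 3) *: comb_form R (flag_diff p.1 p.2).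
Proof.
move=> /(allP pair_flag_diff_row)/allP p0.
rewrite duality_op_decomp big1 ?subr0 // => m _.
by rewrite ev_comb_form (eqP (p0 m (mem_ords m))) scale0r.
Qed.

(** In each block of seven coordinates x_k, sum x_k f_k = (sum x_k) f_0 - sum_{k > 0} x_k (f_0 -
    f_k). *)
Lemma flag_expansion F :
  F = \sum_m ev F (theta_row m) *: comb_form R (flag48 (m, 0))
      - \sum_(p <- idx48) ev F (flag48 p) *: comb_form R (flag_diff p.1 p.2).
Proof.
apply: kform_eq => // s sT; have /(ev_same_comb F) := allP expansion_check _ sT.
rewrite !ev1 => ->; rewrite ev_cat !ev_flatten -[in RHS]ev1 evD -scaleN1r evZ.
rewrite !ev_sum sum_ords mulN1r -sumrN; congr (_ + _); apply: eq_bigr => m _.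
  by rewrite evZ ev1 cmpt_comb_form ev_scale mulrC.
by rewrite evZ ev1 cmpt_comb_form ev_scale rmorphN mulNr mulrC.
Qed.

(** * Equivariance of the duality operator *)

Lemma cmpt_theta_row m s : size s = 3 -> cmpt (v m) s = cmpt (Theta R) (m :: s).
Proof.
move=> s3; pose t := Tuple (introT eqP s3).
rewrite -[s]/(tval t) cmpt_ssort -cat1s cmpt_cat_ssort.
have [->|] := ssort_sorted t isT; first by rewrite !mul0r.
move: (ssort t) => -[c r] /= rw; congr (_ * _).
have /eqP r3 : size r = 3.
  by move: rw; rewrite mem_filter => /andP[_ /size_words].
rewrite (cmpt_Theta R [tuple of m :: Tuple r3]) cmpt_comb_form.
by have /allP/(_ m (mem_ords m))/eqP-> := allP theta_row_check _ rw.
Qed.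

(** In the component of A.Theta = 0 at [m :: t], the first slot gives the sum over [j], and the
    other slots give the action on v_m. *)
Lemma act_theta_row A m : A \in spin7 R ->
  kform_act A (v m) = - \sum_j A m j *: v j.
Proof.
move=> /stabilizer_invariant AT; apply: cmpt_inj => t.
have := cmpt_act A (Theta R) [tuple of m :: t].
rewrite AT -ev1 ev0 big_ord_recl => /esym/eqP; rewrite addr_eq0 => /eqP e.
rewrite cmpt_act -[RHS]ev1 -scaleN1r evZ mulN1r ev_sum.
under [X in _ = - X]eq_bigr => j _ do
  rewrite evZ ev1 cmpt_theta_row ?size_tuple //
    -[j :: t]/(tval [tuple of j :: t]) -(subst_idx_cons0 m) -{1}[m](tnth0 m t).
rewrite e opprK; apply: eq_bigr => p _; apply: eq_bigr => j _.
by rewrite cmpt_theta_row ?size_tuple // subst_idx_consS tnthS.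
Qed.

(** Up to the factor 6, s_m is the inner product with v_m, so skew-adjointness of the action
    transfers [act_theta_row]. *)
Lemma ev_act_theta_row A m F : A \in spin7 R ->
  ev (kform_act A F) (theta_row m) = \sum_j A m j * ev F (theta_row j).
Proof.
move=> As; have six0 : (6 : R) != 0 by rewrite pnatr_eq0.
have /andP[Aso _] := As.
apply: (mulfI six0); rewrite -dot_comb_form /=.
rewrite dotC dot_act // dotC -[tensor_act _ _]/(vsval (kform_act A (v m))).
have -> : kform_act A (v m) = \sum_j (- A m j) *: v j.
  by rewrite act_theta_row // -sumrN; apply: eq_bigr => j _; rewrite scaleNr.
rewrite mulr_sumr.
rewrite (big_morph (fun G => dot (vsval G) (vsval F)) (op1 := +%R) (id1 := 0)).
- rewrite -sumrN; apply: eq_bigr => j _.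
  rewrite -[X in vsval X]addr0 [vsval _]linearP dotP linear0 dot0 addr0.
  rewrite mulNr opprK.
  by rewrite dot_comb_form mulrCA.
- move=> G H; rewrite -[G in LHS]scale1r [vsval _]linearP dotP mul1r.
  by rewrite dotC.
- by rewrite linear0 dot0.
Qed.

Lemma duality_act A F : A \in spin7 R -> b (kform_act A F) = kform_act A (b F).
Proof.
move=> As; rewrite !duality_op_decomp linearZ /=; congr (_ *: _).
rewrite linearB /=; congr (_ - _); rewrite linear_sum /=.
have /andP[/eqP Aso _] := As.
rewrite (eq_bigr (fun m =>
  \sum_j (A m j * ev F (theta_row j)) *: v m)) => [|m _].
  rewrite exchange_big /=; apply: eq_bigr => j _.
  rewrite linearZ /= act_theta_row //.
  rewrite scalerN scaler_sumr -sumrN; apply: eq_bigr => m _.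
  rewrite scalerA -scaleNr mulrC -mulrN; congr ((_ * _) *: _).
  by move/matrixP/(_ j m): Aso; rewrite !mxE.
by rewrite ev_act_theta_row // scaler_suml.
Qed.

(** * The two eigenspaces and the quadratic relation *)

Lemma memv_leigen (f : 'End(kform R 8 3)) a F :
  (F \in leigenspace f a) = (f F == a *: F).
Proof.
by rewrite memv_ker add_lfunE opp_lfunE scale_lfunE id_lfunE subr_eq0.
Qed.

Lemma leigen_submodule a : submodule (spin7 R) (leigenspace b a).
Proof.
move=> A F As; rewrite !memv_leigen => /eqP bF.
by rewrite duality_act // bF linearZ.
Qed.

Lemma leigen8E : leigenspace b (- 4) = <<[seq v m | m <- ords]>>%VS.
Proof.
apply/eqP; rewrite eqEsubv; apply/andP; split; last first.
  by apply/span_subvP => _ /mapP[m _ ->]; rewrite memv_leigen duality_theta_row.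
apply/subvP => F; rewrite memv_leigen duality_op_decomp => /eqP.
set S := \sum_m _ => e.
(* From (2/3)(F - S) = -4 F follows (2/3) S = (14/3) F. *)
have -> : F = 7^-1 *: S.
  have c0 : 2 / 3 != 0 :> R by rewrite mulf_eq0 invr_eq0 !pnatr_eq0.
  have e' : (2 / 3) *: S = (14 / 3) *: F.
    have -> : (2 / 3) *: S = (2 / 3) *: F - (2 / 3) *: (F - S).
      by rewrite scalerBr subKr.
    by rewrite e -scalerBl; congr (_ *: _); field.
  apply: (scalerI c0); rewrite [RHS]scalerA [_ * 7^-1]mulrC -[RHS]scalerA.
  rewrite e' scalerA.
  by congr (_ *: _); field.
rewrite memvZ // /S memv_suml // => m _.
by rewrite memvZ // memv_span // (map_f (fun m => v m)) ?mem_ords.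
Qed.

Lemma leigen48E : leigenspace b (2 / 3) =
  <<[seq comb_form R (flag_diff p.1 p.2) | p <- idx48]>>%VS.
Proof.
apply/eqP; rewrite eqEsubv; apply/andP; split; last first.
  apply/span_subvP => _ /mapP[p pI ->].
  by rewrite memv_leigen duality_flag_diff.
apply/subvP => F; rewrite memv_leigen duality_op_decomp => /eqP.
have c0 : 2 / 3 != 0 :> R by rewrite mulf_eq0 invr_eq0 !pnatr_eq0.
move=> /(scalerI c0)/eqP; rewrite subr_eq addrC -subr_eq subrr => /eqP S0.
(* The v_m are orthogonal with square norm 7, so the vanishing of sum s_m(F) v_m kills each s_m(F);
   the expansion then keeps only the differences. *)
have F0 m : ev F (theta_row m) = 0.
  have := congr1 (fun G => ev G (theta_row m)) S0; rewrite /= ev0 ev_sum.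
  rewrite (bigD1 m) //= evZ ev_theta_row eqxx big1 ?addr0 => [|m' nm].
    by rewrite mul1r => /esym/eqP; rewrite mulf_eq0 pnatr_eq0 orbF => /eqP.
  by rewrite evZ ev_theta_row (negPf nm) mul0r mulr0.
rewrite [F]flag_expansion big1 => [|m _]; last by rewrite F0 scale0r.
rewrite sub0r memvN big_seq memv_suml // => p pI.
rewrite memvZ // memv_span //.
exact: (map_f (fun p => comb_form R (flag_diff p.1 p.2))).
Qed.

(** The image of b - 2/3 lies in the span of the v_m, which b + 4 annihilates; hence (b + 4)(b -
    2/3) = 0. *)
Lemma duality_sqr F : b (b F) = (8 / 3) *: F - (10 / 3) *: b F.
Proof.
have [S bF bS] : exists2 S, b F = (2 / 3) *: (F - S) & b S = (- 4) *: S.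
  exists (\sum_m ev F (theta_row m) *: v m); first exact: duality_op_decomp.
  rewrite linear_sum scaler_sumr /=; apply: eq_bigr => m _.
  by rewrite linearZ /= duality_theta_row scalerA mulrC -scalerA.
have -> : b (b F) = (2 / 3) *: (b F - b S) by rewrite {1}bF linearZ linearB.
rewrite bS; have -> : S = F - (3 / 2) *: b F.
  rewrite bF scalerA (_ : 3 / 2 * (2 / 3) = 1); last by field.
  by rewrite scale1r subKr.
apply: cmpt_inj => t; rewrite -!ev1 -!scaleN1r !(evD, evZ); by field.
Qed.

Lemma dim_leigen8 : \dim (leigenspace b (- 4)) = 8%N.
Proof.
rewrite leigen8E (@dim_dual _ _ _ theta_row 7) ?pnatr_eq0 //.
by move=> i j _ _; apply: ev_theta_row.
Qed.

Lemma dim_leigen48 : \dim (leigenspace b (2 / 3)) = 48%N.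
Proof.
rewrite leigen48E (@dim_dual _ _ _ flag48 (-1)) //.
  by rewrite oppr_eq0 oner_eq0.
move=> p q pI qI; rewrite ev_comb_form.
have /allP/(_ q qI)/eqP-> := allP pair_flag_diff_dual p pI.
by case: (p == q); rewrite ?mul1r ?mul0r ?oppr0.
Qed.

Lemma leigenvalue_duality (a : R) :
  leigenvalue b a <-> a = - 4 \/ a = 2 / 3.
Proof.
split=> [ba|].
  have := memv_pick (leigenspace b a); rewrite memv_leigen => /eqP bu.
  have := duality_sqr (vpick (leigenspace b a)).
  rewrite bu linearZ /= bu !scalerA -scalerBl => /eqP.
  rewrite -subr_eq0 -scalerBl scaler_eq0 vpick0 (negPf ba) orbF => /eqP e.
  have : (a + 4) * (a - 2 / 3) = 0 by rewrite -e; field.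
  move=> /eqP; rewrite mulf_eq0 addr_eq0 subr_eq0.
  by case/orP => /eqP->; [left | right].
have nz c : \dim (leigenspace b c) != 0%N -> leigenvalue b c.
  by apply: contraNneq => ->; rewrite dimv0.
by case=> ->; apply: nz; [rewrite dim_leigen8 | rewrite dim_leigen48].
Qed.

Lemma irreducible_leigen8 : irreducible (spin7 R) (leigenspace b (- 4)).
Proof.
apply: (irreducible_linked _ _ _ theta_row_linked); last exact: isT.
- exact: leigen_submodule.
- by rewrite leigen8E flatten_map1 -map_comp.
- move=> l; rewrite flatten_map1 => /mapP[m mI ->].
  exists (projector8 m), 324; split; last by [].
  exact: (allP projector8_rank1 m mI).
Qed.

Lemma irreducible_leigen48 : irreducible (spin7 R) (leigenspace b (2 / 3)).
Proof.
have diffsE : flatten [seq [seq flag_diff m k | k <- iota 1 6] | m <- ords] =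
  [seq flag_diff p.1 p.2 | p <- idx48].
  by rewrite map_allpairs.
apply: (irreducible_linked _ _ _ flag_diff_linked); last exact: isT.
- exact: leigen_submodule.
- by rewrite leigen48E diffsE -map_comp.
- move=> l; rewrite diffsE => /mapP[p pI ->].
  exists (projector48 p.1 p.2), (-324); split; last by [].
  exact: (allP projector48_rank1 p pI).
Qed.


Lemma leigen_cap : (leigenspace b (- 4) :&: leigenspace b (2 / 3))%VS = 0%VS.
Proof.
apply/eqP; rewrite -subv0; apply/subvP => F; rewrite memv_cap => /andP[F8 F48].
move: F8; rewrite memv_leigen => /eqP bF; move: F48; rewrite memv_leigen bF.
move=> /eqP/esym eqF; rewrite memv0; apply/eqP.
rewrite -[F]scale1r (_ : 1 = 3 / 14 * (2 / 3) - 3 / 14 * - 4); last by field.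
by rewrite scalerBl -(scalerA _ (2 / 3)) -(scalerA _ (- 4)) eqF subrr.
Qed.

Lemma leigen_sum : (leigenspace b (- 4) + leigenspace b (2 / 3))%VS = fullv.
Proof.
apply/eqP; rewrite eqEsubv subvf /=; apply/subvP => F _.
(* The spectral projections; 14/3 is the gap between the eigenvalues, and the quadratic relation
   places each summand in its eigenspace. *)
have -> : F = - (3 / 14) *: (b F - (2 / 3) *: F) + (3 / 14) *: (b F + 4 *: F).
  by apply: cmpt_inj => t; rewrite -!ev1 -!scaleN1r !(evD, evZ); field.
apply: memv_add; rewrite memvZ // memv_leigen; apply/eqP; apply: cmpt_inj => t.
all: rewrite !linearD /= ?linearN !linearZ /= duality_sqr -!ev1 -!scaleN1r.
all: by rewrite !(evD, evZ); field.
Qed.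

(** * Uniqueness of the irreducible submodules of dimensions 8 and 48 *)

Lemma image_submodule a W : submodule (spin7 R) W ->
  submodule (spin7 R) ((b - a *: \1%VF) @: W)%VS.
Proof.
move=> subW A _ As /memv_imgP[F FW ->].
suff -> : kform_act A ((b - a *: \1%VF)%VF F) =
    (b - a *: \1%VF)%VF (kform_act A F).
  by rewrite memv_img ?subW.
rewrite !add_lfunE !opp_lfunE !scale_lfunE !id_lfunE duality_act //.
by rewrite linearB linearZ.
Qed.

(** Schur's argument: if b - a were injective on [W], its image would be a nonzero submodule of the
    irreducible c-eigenspace, hence all of it, against the dimensions. *)
Lemma sub_leigen_irreducible (a c : R) W :
  irreducible (spin7 R) W -> irreducible (spin7 R) (leigenspace b c) ->
  (forall F, b F - a *: F \in leigenspace b c) ->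
  \dim W != \dim (leigenspace b c) -> (W <= leigenspace b a)%VS.
Proof.
move=> [subW W0 irrW] [_ _ irrc] abc dimW.
have subK : submodule (spin7 R) (W :&: leigenspace b a)%VS.
  move=> A F As; rewrite !memv_cap => /andP[FW Fa].
  by rewrite subW // leigen_submodule.
have [K0|/capv_idPl//] := irrW _ subK (capvSl _ _).
have := limg_ker_dim (b - a *: \1%VF) W; rewrite -[lker _]/(leigenspace b a) K0.
rewrite dimv0 add0n => dimf.
have [|f0|fc] := irrc _ (image_submodule (a := a) subW).
- apply/subvP => _ /memv_imgP[F _ ->].
  by rewrite add_lfunE opp_lfunE scale_lfunE id_lfunE abc.
- by move: dimf W0; rewrite f0 dimv0 -dimv_eq0 => <-.
- by move: dimW; rewrite -dimf fc eqxx.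
Qed.

Lemma irreducible_dim8 W :
  irreducible (spin7 R) W /\ \dim W = 8 <-> W = leigenspace b (- 4).
Proof.
split=> [[irrW dimW]|->]; last first.
  by split; [apply: irreducible_leigen8 | apply: dim_leigen8].
apply/eqP; rewrite eqEdim dim_leigen8 dimW leqnn andbT.
apply: (sub_leigen_irreducible irrW irreducible_leigen48) => [F|].
  rewrite memv_leigen; apply/eqP; apply: cmpt_inj => t.
  rewrite linearB linearZ /= duality_sqr -!ev1 -!scaleN1r !(evD, evZ).
  by field.
by rewrite dimW dim_leigen48.
Qed.

Lemma irreducible_dim48 W :
  irreducible (spin7 R) W /\ \dim W = 48 <-> W = leigenspace b (2 / 3).
Proof.
split=> [[irrW dimW]|->]; last first.
  by split; [apply: irreducible_leigen48 | apply: dim_leigen48].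
apply/eqP; rewrite eqEdim dim_leigen48 dimW leqnn andbT.
apply: (sub_leigen_irreducible irrW irreducible_leigen8) => [F|].
  rewrite memv_leigen; apply/eqP; apply: cmpt_inj => t.
  rewrite linearB linearZ /= duality_sqr -!ev1 -!scaleN1r !(evD, evZ).
  by field.
by rewrite dimW dim_leigen8.
Qed.

Lemma has_order_duality : has_order b 2.
Proof.
exists [:: -4; 2 / 3]; split=> // [|a].
  rewrite /= inE andbT; apply/eqP => e.
  have : (14 : R) = 3 * (2 / 3 - - 4) by field.
  by rewrite -e subrr mulr0 => /eqP; rewrite pnatr_eq0.
apply/idP/idP => [/leigenvalue_duality[->|->]|].
- by rewrite mem_head.
- by rewrite !inE eqxx orbT.
rewrite !inE => /orP[/eqP->|/eqP->]; apply/leigenvalue_duality.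
  by left.
by right.
Qed.

Lemma num_irreducibles_duality : @num_irreducibles R 8 (spin7 R) 3 2.
Proof.
exact: num_irreducibles2 irreducible_leigen8 irreducible_leigen48
  leigen_sum leigen_cap.
Qed.

End Irreducibility.

Theorem proposition3p2 (R : realType) :
  let b : 'End(kform R 8 3) := duality_op (Theta R) in
  [/\ (forall (F : kform R 8 3) (t : 3.-tuple 'I_8),
         vsval (b F) t =
         \sum_(u : 3.-tuple 'I_8) duality_kernel (Theta R) t u * vsval F u),
      has_order b 2 /\ perfect (spin7 R) (Theta R) b,
      (b \o b)%VF = (8 / 3 : R) *: \1%VF - (10 / 3 : R) *: b,
      (forall a : R, leigenvalue b a <-> a = - 4 \/ a = 2 / 3)
    & (forall W : {vspace kform R 8 3},
         irreducible (spin7 R) W /\ \dim W = 8%N <->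
         W = leigenspace b (- 4)) /\
      (forall W : {vspace kform R 8 3},
         irreducible (spin7 R) W /\ \dim W = 48%N <->
         W = leigenspace b (2 / 3))].
Proof.
move=> b; split.
- exact: duality_op_kernel.
- split; first exact: has_order_duality.
  split; first exact: stabilizer_so_subalgebra.
    exact: stabilizer_invariant.
  by exists 2; [apply: has_order_duality | apply: num_irreducibles_duality].
- apply/lfunP => F.
  rewrite comp_lfunE add_lfunE opp_lfunE !scale_lfunE id_lfunE.
  exact: duality_sqr.
- exact: leigenvalue_duality.
- by split=> W; [apply: irreducible_dim8 | apply: irreducible_dim48].
Qed.
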